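(* There exists a merely finitely additive probability function $P:\mathcal B\to[0,1]$ satisfying $P([\omega\upharpoonright n])>0$ for all $\omega\in\Omega$, $n\in\mathbb N$, such that for every $A\in\mathcal B$, $P_n(A)\to\mathbf 1_A$ $P$-almost surely. Consequently, the following assertion is false: ''every probability function $P$ on $\mathcal B$ satisfying $P([\omega\upharpoonright n])>0$ for all $\omega,n$ is countably additive if and only if $P_n(A)\to\mathbf 1_A$ $P$-almost surely for every $A\in\mathcal B$.''
   Context: $\mathbb N=\{1,2,3,\dots\}$; $\Omega=\{0,1\}^{\mathbb N}$ carries the product topology, and $\mathcal B$ is its Borel $\sigma$-algebra. For $\omega\in\Omega$, $n\in\mathbb N$, $[\omega\upharpoonright n]=\{\omega':\omega'_i=\omega_i,\ 1\le i\le n\}$. A probability function on $\mathcal B$ is a finitely additive map $P:\mathcal B\to[0,1]$ with $P(\Omega)=1$; it is merely finitely additive if it is not countably additive. The posterior is $P_n(A)(\omega)=P(A\cap[\omega\upharpoonright n])/P([\omega\upharpoonright n])$. ''$P_n(A)\to\mathbf 1_A$ $P$-almost surely'' means $P(\{\omega:P_n(A)(\omega)\to\mathbf 1_A(\omega)\})=1$. *)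

(* Defs.v *)
From mathcomp Require Import all_boot all_order all_algebra.
From mathcomp Require Import all_classical all_reals all_analysis.
From mathcomp Require Import measurable_realfun.
Set Implicit Arguments.
Unset Strict Implicit.
Unset Printing Implicit Defensive.
Import Order.TTheory GRing.Theory Num.Theory.
Import numFieldNormedType.Exports.
Local Open Scope classical_set_scope.
Local Open Scope ring_scope.

(* [cantor_space] is [nat -> bool] with the product topology. Coordinates are
   numbered from 0, so [w i] is the (i+1)-st coordinate of a sequence indexed
   by {1, 2, ...}. *)
Definition Omega : measurableType _ := g_sigma_algebraType (@open cantor_space).

(* The first n coordinates are those of index i < n. *)
Definition cylinder (w : Omega) (n : nat) : set Omega :=
  [set w' | forall i : nat, (i < n)%N -> w' i = w i].

Section probability_function.
Context {R : realType}.
Implicit Types (P : {content set Omega -> \bar R}) (A : set Omega).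

(* A content is finitely additive on measurable sets; its values on the other
   subsets of Omega carry no meaning. Once P setT = 1, P takes its values in
   [0, 1] on measurable sets. *)
Definition probability_function P := P [set: Omega] = 1%E.

Definition merely_finitely_additive P := ~ sigma_additive P.

Definition positive_on_cylinders P :=
  forall (w : Omega) (n : nat), (0 < n)%N -> (0 < P (cylinder w n))%E.

Definition posterior P (n : nat) A (w : Omega) : R :=
  fine (P (A `&` cylinder w n)) / fine (P (cylinder w n)).

Definition convergence_set P A : set Omega :=
  [set w | posterior P n A w @[n --> \oo] --> (\1_A w : R)].

Definition posterior_cvg_as P A := P (convergence_set P A) = 1%E.

End probability_function.

Lemma open_cylinder (w : Omega) (n : nat) :
  open (cylinder w n : set cantor_space).
Proof.
elim: n => [|n IHn].
  by rewrite (_ : cylinder w 0 = setT); [exact: openT|apply/seteqP; split].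
rewrite (_ : cylinder w n.+1 =
  cylinder w n `&` (proj n : cantor_space -> bool) @^-1` [set w n]).
  apply: openI => //; apply: open_comp; last exact: discrete_open.
  by move=> x _; exact: (@proj_continuous nat (fun=> bool)).
apply/seteqP; split => w' /=.
  by move=> h; split=> [i /= /ltnW ?|]; exact: h.
by move=> [h hn] i; rewrite ltnS leq_eqVlt => /predU1P[->//|]; exact: h.
Qed.

Lemma measurable_cylinder (w : Omega) (n : nat) : measurable (cylinder w n).
Proof. by apply: sub_sigma_algebra; exact: open_cylinder. Qed.

Lemma cylinder_eq (w w' : Omega) (n : nat) :
  cylinder w n w' -> cylinder w' n = cylinder w n.
Proof.
by move=> h; apply/seteqP; split => v hv i ni; rewrite hv ?h.
Qed.

Section convergence_set.
Context {R : realType} (P : {content set Omega -> \bar R}).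

Lemma measurable_posterior (n : nat) (A : set Omega) :
  measurable_fun setT (posterior P n A).
Proof.
move=> _ B _; rewrite setTI; apply: sub_sigma_algebra.
rewrite (_ : _ @^-1` _ =
  \bigcup_(w in posterior P n A @^-1` B) cylinder w n).
  by apply: bigcup_open => w _; exact: open_cylinder.
apply/seteqP; split => [w Bw|w [v Bv /cylinder_eq vw]] /=; first by exists w.
by rewrite /posterior vw.
Qed.

(* Hence [posterior_cvg_as] only evaluates P on measurable sets. *)
Lemma measurable_convergence_set (A : set Omega) :
  measurable A -> measurable (convergence_set P A).
Proof.
move=> mA.
rewrite (_ : convergence_set P A =
    \bigcap_k \bigcup_N \bigcap_(n in [set n | (N <= n)%N])
      ((fun w => `|\1_A w - posterior P n A w|) @^-1`
        [set` `]-oo, k.+1%:R^-1[])).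
  apply: bigcapT_measurable => k; apply: bigcupT_measurable => N.
  apply: bigcap_measurableType => n _; rewrite -[X in measurable X]setTI.
  suff : measurable_fun setT (fun w => `|\1_A w - posterior P n A w| : R).
    by apply => //; exact: measurable_itv.
  apply: measurableT_comp => //; apply: measurable_funB.
    exact: measurable_indic.
  exact: measurable_posterior.
apply/seteqP; split => w /=.
  move=> /cvgrPdist_lt h k _.
  have [N _ hN] : \forall n \near \oo,
      `|\1_A w - posterior P n A w| < k.+1%:R^-1 :> R.
    by apply: h; rewrite invr_gt0.
  by exists N => // n /= Nn; rewrite in_itv /=; exact: hN.
move=> h; apply/cvgrPdist_lt => e e0.
have [k ke] : exists k : nat, k.+1%:R^-1 < e.
  exists (Num.truncn e^-1); rewrite invf_plt ?posrE//.
  exact: truncnS_gt.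
have [N _ hN] := h k I.
exists N => // n /= Nn; have := hN n Nn.
by rewrite /= in_itv /= => /lt_trans; exact.
Qed.

End convergence_set.

(* Main.v *)
Require Import Defs.
From HB Require Import structures.
From mathcomp Require Import all_boot all_order all_algebra.
From mathcomp Require Import all_classical all_reals all_analysis.
Import Order.TTheory GRing.Theory Num.Theory.
Import numFieldNormedType.Exports.
Local Open Scope classical_set_scope.
Local Open Scope ring_scope.
Set Implicit Arguments.
Unset Strict Implicit.
Unset Printing Implicit Defensive.

(** Let [mu] be a countably additive probability carried by the countable dense
set D of eventually zero sequences and charging every point of D, and let [G] be
an ultrafilter containing every set which contains all but finitely many of the
points 1^k 0^oo of D. The mean P of [mu] and of the two-valued content of [G]
gives mass 1 to D. A point a of D differs from the limit 1^oo of the points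
1^k 0^oo, so small cylinders around a are not in [G]; there the posteriors of P
are those of [mu], and these converge to the indicator because a is an atom of
[mu]. Finally P is not countably additive because the cylinders [1^k 0] are not
in [G] whereas their union is. *)

(** * The mean of a probability and the two-valued content of an ultrafilter *)

Section ultrafilter_mixture.
Context {d} {T : measurableType d} {R : realType}.
Variables (mu : probability T R) (G : set_system T).
Hypothesis GU : UltraFilter G.

Definition ultrafilter_mixture (A : set T) : \bar R :=
  ((2^-1)%:E * (mu A + (`[< G A >]%:R)%:E))%E.

Lemma ultrafilter_mixture_ge0 A : (0 <= ultrafilter_mixture A)%E.
Proof. by rewrite mule_ge0 ?adde_ge0 ?lee_fin ?invr_ge0. Qed.

(** Disjoint sets cannot both lie in [G]. If [A] does not, its complement does, and intersecting
    that with the union forces [B] into [G]. *)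
Lemma ultrafilter_asboolU (A B : set T) : A `&` B = set0 ->
  (`[< G (A `|` B) >] = `[< G A >] + `[< G B >] :> nat)%N.
Proof.
move=> AB0.
have GAB : ~ (G A /\ G B).
  move=> [GA GB]; apply: (@filter_not_empty _ G _).
  by rewrite -AB0; exact: filterI.
have [/[dup] GA /asboolT->|/[dup] GA /asboolF->] := pselect (G A);
have [/[dup] GB /asboolT->|/[dup] GB /asboolF->] := pselect (G B) => //=.
- by case: GAB.
- by rewrite asboolT //; exact: filterS (@subsetUl _ A B) GA.
- by rewrite asboolT //; exact: filterS (@subsetUr _ A B) GB.
- rewrite asboolF // => GAB'.
  have [//|GAc] := in_ultra_setVsetC A GU.
  by apply: GB; apply: filterS (filterI GAB' GAc) => x [[]].
Qed.

Lemma ultrafilter_mixture_semi_additive :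
  measure_function.semi_additive ultrafilter_mixture.
Proof.
apply/additive2P.
  have G0 : ~ G set0 by exact: filter_not_empty.
  by rewrite /ultrafilter_mixture measure0 add0e (asboolF G0) mulr0n mule0.
move=> A B mA mB AB0; rewrite /ultrafilter_mixture.
rewrite measureU// ultrafilter_asboolU// natrD EFinD addeACA ge0_muleDr//.
- by rewrite adde_ge0.
- by rewrite adde_ge0.
Qed.

HB.instance Definition _ := isContent.Build _ _ _ ultrafilter_mixture
  ultrafilter_mixture_ge0 ultrafilter_mixture_semi_additive.

Lemma ultrafilter_mixture_in A : G A ->
  ultrafilter_mixture A = ((2^-1)%:E * (mu A + 1))%E.
Proof. by move=> GA; rewrite /ultrafilter_mixture asboolT. Qed.

Lemma ultrafilter_mixture_notin A : ~ G A ->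
  ultrafilter_mixture A = ((2^-1)%:E * mu A)%E.
Proof. by move=> GA; rewrite /ultrafilter_mixture asboolF// mulr0n adde0. Qed.

Lemma ultrafilter_mixture_full A : mu A = 1%E -> G A ->
  ultrafilter_mixture A = 1%E.
Proof.
move=> muA /ultrafilter_mixture_in->.
by rewrite muA -EFinD -EFinM mulVf// pnatr_eq0.
Qed.

Lemma ultrafilter_mixture_gt0 A : (0 < mu A)%E -> (0 < ultrafilter_mixture A)%E.
Proof.
move=> muA; rewrite mule_gt0// ?lte_fin ?invr_gt0//.
by rewrite (lt_le_trans muA)// leeDl// lee_fin.
Qed.

End ultrafilter_mixture.

(** * Convergence of posteriors at an atom *)

Lemma bigcap_cylinder (w : Omega) : \bigcap_n cylinder w n = [set w].
Proof.
apply/seteqP; split => [v h|_ -> //].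
by apply/funext => i; exact: (h i.+1).
Qed.

Lemma measurable_singleton (w : Omega) : measurable [set w].
Proof.
rewrite -bigcap_cylinder; apply: bigcapT_measurable => n.
exact: measurable_cylinder.
Qed.

Section posterior_at_atom.
Context {R : realType} (mu : probability Omega R) (a : Omega).

(** Continuity from above of [mu] along the cylinders, which decrease to the singleton of [a]. *)
Lemma cvg_probability_cylinder (A : set Omega) : measurable A ->
  fine (mu (A `&` cylinder a n)) @[n --> \oo] --> fine (mu (A `&` [set a])).
Proof.
move=> mA.
apply: fine_cvg.
rewrite fineK; last first.
  exact: fin_num_measure (measurableI _ _ mA (measurable_singleton a)).
rewrite -bigcap_cylinder -bigcapIr; last by exists 0%N.
apply: (@nonincreasing_cvg_mu _ _ _ mu (fun n => A `&` cylinder a n)).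
- apply: (le_lt_trans (probability_le1 _ _)); last by rewrite ltry.
  by apply: measurableI => //; exact: measurable_cylinder.
- by move=> n; apply: measurableI => //; exact: measurable_cylinder.
- apply: bigcapT_measurable => n.
  by apply: measurableI => //; exact: measurable_cylinder.
- move=> m n mn; apply/subsetPset; apply: setIS => w h i im.
  by apply: h; exact: leq_trans mn.
Qed.

(** For [n >= m] the factor [c] cancels in the posterior, leaving that of [mu]. Its limit is the
    quotient of the masses of [A] meet {a} and of {a}, which is 1 or 0 according to whether [a] is
    in [A]. *)
Lemma convergence_set_atom (P : {content set Omega -> \bar R}) A c m :
  measurable A -> (0 < mu [set a])%E -> c != 0 ->
  (forall B, B `<=` cylinder a m -> P B = (c%:E * mu B)%E) ->
  convergence_set P A a.
Proof.
move=> mA mua c0 Pmu; rewrite /convergence_set /=.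
have mua_fin : mu [set a] \is a fin_num.
  exact: fin_num_measure (measurable_singleton a).
have mua0 : fine (mu [set a]) != 0.
  by rewrite gt_eqF// fine_gt0// mua ltey_eq mua_fin.
have cvgr : fine (mu (A `&` cylinder a n)) / fine (mu (cylinder a n))
    @[n --> \oo] --> fine (mu (A `&` [set a])) / fine (mu [set a]).
  apply: cvgM; first exact: cvg_probability_cylinder.
  apply: cvgV => //.
  have := @cvg_probability_cylinder setT measurableT; rewrite setTI.
  by under eq_fun do rewrite setTI.
have -> : \1_A a = fine (mu (A `&` [set a])) / fine (mu [set a]).
  rewrite indicE; have [aA|aA] := boolP (a \in A).
    by rewrite setIC set1I aA divff.
  by rewrite setIC set1I (negbTE aA) measure0 mul0r.
apply: cvg_trans cvgr; apply: near_eq_cvg.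
exists m => // n /= mn.
have sub : cylinder a n `<=` cylinder a m.
  by move=> w h i im; apply: h; exact: leq_trans mn.
rewrite /posterior !Pmu//; last by apply: subset_trans sub; exact: subIsetr.
rewrite !fineM// ?fin_num_measure//; last 2 first.
- exact: measurable_cylinder.
- by apply: measurableI => //; exact: measurable_cylinder.
by rewrite -mulf_div divff// mul1r.
Qed.

End posterior_at_atom.

(** * The eventually zero sequences and a probability carried by them *)

(** An enumeration of D: [k] is decoded to a finite word, which is padded with zeros. A number that
    codes no word gives the zero sequence. *)
Definition eventually_zero (k : nat) : Omega :=
  fun i => nth false (odflt [::] (unpickle k)) i.

Definition initial_ones (k : nat) : Omega := fun i => (i < k)%N.

Lemma eventually_zeroE (s : seq bool) :
  eventually_zero (pickle s) = (fun i => nth false s i).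
Proof. by rewrite /eventually_zero pickleK. Qed.

Lemma eventually_zero_false k : exists i, eventually_zero k i = false.
Proof.
exists (size (odflt [::] (unpickle k : option (seq bool)))).
exact: nth_default.
Qed.

Lemma initial_ones_eventually_zero k :
  initial_ones k = eventually_zero (pickle (nseq k true)).
Proof.
by rewrite eventually_zeroE; apply/funext => i; rewrite nth_nseq; case: ifP.
Qed.

Lemma measurable_eventually_zero : measurable_fun setT eventually_zero.
Proof. by []. Qed.

HB.instance Definition _ :=
  isMeasurableFun.Build _ _ _ _ eventually_zero measurable_eventually_zero.

Section counterexample.
Context {R : realType}.

(** The Poisson law of parameter 1 serves as a probability on [nat] that charges every point; its
    image charges every point of D. *)
Definition atomic_probability : probability Omega R :=
  distribution (poisson_prob (1 : R) 0) eventually_zero.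

Lemma atomic_probabilityE A :
  atomic_probability A = poisson_prob 1 0 (eventually_zero @^-1` A).
Proof. by []. Qed.

Lemma atomic_probability_gt0 k (A : set Omega) : A (eventually_zero k) ->
  (0 < atomic_probability A)%E.
Proof.
move=> Ak; rewrite atomic_probabilityE.
apply: (@lt_le_trans _ _ (poisson_prob (1 : R) 0 [set k])).
  rewrite /poisson_prob ltr01 esum_set1; last first.
    by rewrite lee_fin poisson_pmf_ge0.
  rewrite lte_fin /poisson_pmf ltr01 expr1n mul1r.
  by rewrite mulr_gt0// ?expR_gt0// invr_gt0 ltr0n fact_gt0.
by apply: le_measure; rewrite ?inE// => _ ->.
Qed.

Lemma atomic_probability1 (A : set Omega) : (forall k, A (eventually_zero k)) ->
  atomic_probability A = 1%E.
Proof.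
move=> h; rewrite atomic_probabilityE.
suff -> : eventually_zero @^-1` A = setT by exact: probability_setT.
by apply/seteqP; split => [|k _] //; exact: h.
Qed.

(** * The properties of the mixture on the Cantor space *)

Variable G : set_system Omega.
Hypothesis GU : UltraFilter G.
Hypothesis G_ones : initial_ones @ \oo `<=` G.

Local Notation P := (ultrafilter_mixture atomic_probability G).

(** For [k > m] the point 1^k 0^oo has a one at index [m], hence lies outside this cylinder, whose
    complement is therefore in [G]. *)
Lemma cylinder_notin (w : Omega) m : w m = false -> ~ G (cylinder w m.+1).
Proof.
move=> wm Gw; have Gc : G (~` cylinder w m.+1).
  apply: G_ones; exists m.+1 => // k /= mk /(_ m (ltnSn m)).
  by rewrite wm /initial_ones mk.
apply: (@filter_not_empty _ G _).
by rewrite -(setICr (cylinder w m.+1)); exact: filterI.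
Qed.

Lemma mixture_positive_on_cylinders : positive_on_cylinders P.
Proof.
move=> w n _; apply: ultrafilter_mixture_gt0.
(* The first [n] coordinates of [w] followed by zeros form a point of D in the cylinder. *)
apply: (@atomic_probability_gt0 (pickle (mkseq w n))) => i ni.
by rewrite eventually_zeroE nth_mkseq.
Qed.

Lemma mixture_convergence_set (A : set Omega) k : measurable A ->
  convergence_set P A (eventually_zero k).
Proof.
move=> mA; have [m km] := eventually_zero_false k.
(* The zero at index [m] is seen by the cylinder of length [m.+1]. No subset of that cylinder is in
   [G], so there the mixture is half the atomic probability. *)
apply: (@convergence_set_atom _ atomic_probability _ _ _ 2^-1 m.+1) => //.
- exact: (@atomic_probability_gt0 k).
- move=> B sB; apply: ultrafilter_mixture_notin => GB.
  by apply: (cylinder_notin km); apply: filterS GB.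
Qed.

Lemma mixture_posterior_cvg (A : set Omega) : measurable A ->
  posterior_cvg_as P A.
Proof.
move=> mA; apply: ultrafilter_mixture_full.
  by apply: atomic_probability1 => k; exact: mixture_convergence_set.
apply: G_ones; exists 0%N => // k _ /=.
by rewrite initial_ones_eventually_zero; exact: mixture_convergence_set.
Qed.

Lemma mixture_merely_finitely_additive : merely_finitely_additive P.
Proof.
(* [F k] fixes the prefix 1^k 0. For [i < j], index [i] carries a zero in [F i] and a one in
   [F j]. *)
pose F k := cylinder (initial_ones k) k.+1.
have mF k : measurable (F k) by exact: measurable_cylinder.
have tF : trivIset setT F.
  apply/trivIsetP => i j _ _.
  wlog ij : i j / (i < j)%N => [H|_].
    rewrite neq_ltn => /orP[] ij; [|rewrite setIC];
      by apply: H; rewrite ?neq_ltn ?ij.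
  apply/seteqP; split => // w [/(_ i (ltnSn i)) wi /(_ i (ltnW ij))].
  by rewrite wi /initial_ones ltnn ij.
have mUF : measurable (\bigcup_k F k) by exact: bigcupT_measurable.
move=> /(_ F mF tF) /=.
have PF k : P (F k) = ((2^-1)%:E * atomic_probability (F k))%E.
  apply: ultrafilter_mixture_notin; apply: cylinder_notin.
  by rewrite /initial_ones ltnn.
under eq_fun => n do rewrite (eq_bigr _ (fun k _ => PF k)).
rewrite ultrafilter_mixture_in; last first.
  (* The union contains every 1^k 0^oo. *)
  by apply: G_ones; exists 0%N => // k _; exists k.
under eq_fun do rewrite -ge0_sume_distrr//.
move=> cvgP.
have cvgmu : ((2^-1)%:E * \sum_(0 <= i < n) atomic_probability (F i))%E
    @[n --> \oo] --> ((2^-1)%:E * atomic_probability (\bigcup_k F k))%E.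
  by apply: cvgeZl => //; exact: measure_semi_sigma_additive.
(* The same partial sums have both limits. As the mass of the union is finite, cancelling it leaves
   1 = 0. *)
have : ((2^-1)%:E * (atomic_probability (\bigcup_k F k) + 1))%E =
    ((2^-1)%:E * atomic_probability (\bigcup_k F k))%E.
  exact: (cvg_unique (@ereal_hausdorff R) cvgP cvgmu).
rewrite -(fineK (fin_num_measure atomic_probability _ mUF)) -EFinD -!EFinM.
have half0 : 2^-1 != 0 :> R by rewrite invr_eq0 pnatr_eq0.
move=> [] /(mulfI half0) /eqP.
by rewrite -subr_eq0 addrAC subrr add0r oner_eq0.
Qed.

End counterexample.

Theorem theorem8p2 (R : realType) :
  (exists P : {content set Omega -> \bar R},
     [/\ probability_function P, merely_finitely_additive P,
         positive_on_cylinders P &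
         forall A : set Omega, measurable A -> posterior_cvg_as P A])
  /\
  ~ (forall P : {content set Omega -> \bar R},
       probability_function P -> positive_on_cylinders P ->
       (sigma_additive P <->
        forall A : set Omega, measurable A -> posterior_cvg_as P A)).
Proof.
suff [P [P1 Pmfa Ppos Pcvg]] : exists P : {content set Omega -> \bar R},
    [/\ probability_function P, merely_finitely_additive P,
        positive_on_cylinders P &
        forall A : set Omega, measurable A -> posterior_cvg_as P A].
  split; first by exists P.
  by move=> /(_ P P1 Ppos)[_ /(_ Pcvg)].
(* The sets containing 1^k 0^oo for all large [k] form a proper filter, which extends to an
   ultrafilter. *)
have [G [GU G_ones]] : exists G, UltraFilter G /\ initial_ones @ \oo `<=` G.
  exact: ultraFilterLemma.
exists (ultrafilter_mixture atomic_probability G); split.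
- apply: ultrafilter_mixture_full; first exact: probability_setT.
  exact: filterT.
- exact: mixture_merely_finitely_additive.
- exact: mixture_positive_on_cylinders.
- by move=> A mA; exact: mixture_posterior_cvg.
Qed.
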